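(* Let $N$ be a finite set and let $A,B,C$ be pairwise disjoint subsets of $N$ with $A,B$ non-empty. All representations of $u_{\langle A,B|C\rangle}$ by elementary imsets in $\mathcal{E}_{\langle A,B|C\rangle}$ are $\sigma$-decomposable if and only if $|A|\le 2$ or $|B|\le 2$.
   Context: Union of sets is written by juxtaposition ($AB=A\cup B$) and a singleton $\{a\}$ is written $a$. For pairwise disjoint $A,B,C\subseteq N$ the semi-elementary imset $u_{\langle A,B|C\rangle}:\mathcal{P}(N)\to\mathbb{Z}$ is the function $\delta_{ABC}+\delta_{C}-\delta_{AC}-\delta_{BC}$, where $\delta_S$ is the indicator function of the point $S\in\mathcal{P}(N)$; it is called elementary if $A,B$ are singletons. Let $\mathcal{E}_{\langle A,B|C\rangle}=\{u_{\langle a,b|\Gamma\rangle}\mid a\in A,\ b\in B,\ C\subseteq\Gamma\subseteq ABC\setminus\{a,b\}\}$. A representation of $u_{\langle A,B|C\rangle}$ is a vector $(\theta_u)_{u\in\mathcal{E}_{\langle A,B|C\rangle}}$ of non-negative integers with $u_{\langle A,B|C\rangle}=\sum_u\theta_u u$. Let $\mathcal{E}^{s,t}_{\langle A,B|C\rangle}$ be the set of $u_{\langle a,b|\Gamma\rangle}\in\mathcal{E}_{\langle A,B|C\rangle}$ with $|A\cap\Gamma|=s$, $|B\cap\Gamma|=t$. It is a fact that in every representation, for each $0\le s\le|A|-1$, $0\le t\le|B|-1$, exactly one $u\in\mathcal{E}^{s,t}_{\langle A,B|C\rangle}$ has $\theta_u=1$ and all others in $\mathcal{E}^{s,t}_{\langle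 A,B|C\rangle}$ have coefficient $0$; denote it $u(s,t)$. So a representation has the form $$u_{\langle A,B|C\rangle}=\sum_{s=0}^{|A|-1}\sum_{t=0}^{|B|-1}u(s,t).\qquad( * )$$ For $1\le s_0\le|A|-1$, the representation $( * )$ is $(s_0,* )$-separable if there is $A_0\subseteq A$ with $|A_0|=s_0$ such that $$u_{\langle A_0,B|C\rangle}=\sum_{s=0}^{s_0-1}\sum_{t=0}^{|B|-1}u(s,t),\qquad u_{\langle A\setminus A_0,B|A_0C\rangle}=\sum_{s=s_0}^{|A|-1}\sum_{t=0}^{|B|-1}u(s,t),$$ these being representations of the respective left-hand sides. For $1\le t_0\le|B|-1$, it is $( *,t_0)$-separable if there is $B_0\subseteq B$ with $|B_0|=t_0$ such that $$u_{\langle A,B_0|C\rangle}=\sum_{s=0}^{|A|-1}\sum_{t=0}^{t_0-1}u(s,t),\qquad u_{\langle A,B\setminus B_0|B_0C\rangle}=\sum_{s=0}^{|A|-1}\sum_{t=t_0}^{|B|-1}u(s,t).$$ $\sigma$-decomposability is defined recursively: a representation $( * )$ of $u_{\langle A,B|C\rangle}$ is $\sigma$-decomposable if at least one of the following holds: (i) $|A|=|B|=1$; (ii) for some $1\le s_0\le|A|-1$ it is $(s_0,* )$-separable and the two resulting representations (of $u_{\langle A_0,B|C\rangle}$ and $u_{\langle A\setminus A_0,B|A_0C\rangle}$) are both $\sigma$-decomposable; (iii) for some $1\le t_0\le|B|-1$ it is $( *,t_0)$-separable and the two resulting representations (of $u_{\langle A,B_0|C\rangle}$ and $u_{\langle A,B\setminus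 B_0|B_0C\rangle}$) are both $\sigma$-decomposable. *)

(* Defs.v *)
From HB Require Import structures.
From mathcomp Require Import all_boot all_order all_algebra.
From mathcomp Require Import finmap.
Set Implicit Arguments.
Unset Strict Implicit.
Unset Printing Implicit Defensive.
Import GRing.Theory.
Local Open Scope ring_scope.

Notation Imset N := {ffun {set N} -> int}.

Definition delta (N : finType) (S : {set N}) : Imset N :=
  [ffun T => (T == S)%:R].

Definition semi_elementary (N : finType) (A B C : {set N}) : Imset N :=
  delta (A :|: B :|: C) + delta C - delta (A :|: C) - delta (B :|: C).

(* The triples (a, b, G) indexing the elementary imsets u_<a,b|G> in the
   set E_<A,B|C>. *)
Definition triples (N : finType) (A B C : {set N}) : {set N * N * {set N}} :=
  [set x : N * N * {set N} |
    [&& x.1.1 \in A, x.1.2 \in B, C \subset x.2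
      & x.2 \subset (A :|: B :|: C) :\: [set x.1.1; x.1.2]]].

Definition elementary (N : finType) (x : N * N * {set N}) : Imset N :=
  semi_elementary [set x.1.1] [set x.1.2] x.2.

Definition elem_set (N : finType) (A B C : {set N}) : {fset Imset N} :=
  [fset elementary x | x in triples A B C]%fset.

Definition elem_layer (N : finType) (A B C : {set N}) (s t : nat) :
    {fset Imset N} :=
  [fset elementary x | x in
    [set x in triples A B C | (#|A :&: x.2| == s) && (#|B :&: x.2| == t)]]%fset.

(* A vector of naturals indexed by E_<A,B|C> is encoded as a function on all
   imsets that vanishes outside E_<A,B|C>. *)
Definition representation (N : finType) (A B C : {set N})
    (theta : Imset N -> nat) : Prop :=
  (forall u, u \notin elem_set A B C -> theta u = 0%N) /\
  semi_elementary A B C = \sum_(u <- elem_set A B C) u *+ theta u.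

(* The imset u(s,t): in a representation with s < #|A| and t < #|B|, exactly
   one u in E^{s,t}_<A,B|C> has coefficient 1, so the default 0 and the order
   of enumeration are irrelevant. *)
Definition rep_at (N : finType) (A B C : {set N}) (theta : Imset N -> nat)
    (s t : nat) : Imset N :=
  head 0 [seq u <- elem_layer A B C s t | theta u == 1%N].

(* The coefficient vector of the sum of the u(s,t) over s1 <= s < s2 and
   t1 <= t < t2. *)
Definition block (N : finType) (A B C : {set N}) (theta : Imset N -> nat)
    (s1 s2 t1 t2 : nat) : Imset N -> nat :=
  fun u => (\sum_(s1 <= s < s2) \sum_(t1 <= t < t2)
              (u == rep_at A B C theta s t))%N.

Definition left_block (N : finType) (A B C : {set N}) (theta : Imset N -> nat)
    (s0 : nat) := block A B C theta 0 s0 0 #|B|.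
Definition right_block (N : finType) (A B C : {set N}) (theta : Imset N -> nat)
    (s0 : nat) := block A B C theta s0 #|A| 0 #|B|.
Definition lower_block (N : finType) (A B C : {set N}) (theta : Imset N -> nat)
    (t0 : nat) := block A B C theta 0 #|A| 0 t0.
Definition upper_block (N : finType) (A B C : {set N}) (theta : Imset N -> nat)
    (t0 : nat) := block A B C theta 0 #|A| t0 #|B|.

(* (s0, * )-separability, with A0 as its witness.  The existential over A0 is
   taken in the recursion below, since the two resulting representations
   depend on A0. *)
Definition separable_A (N : finType) (A B C : {set N})
    (theta : Imset N -> nat) (s0 : nat) (A0 : {set N}) : Prop :=
  [/\ A0 \subset A, #|A0| = s0,
      representation A0 B C (left_block A B C theta s0)
    & representation (A :\: A0) B (A0 :|: C) (right_block A B C theta s0)].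

(* ( *, t0)-separability, with B0 as its witness. *)
Definition separable_B (N : finType) (A B C : {set N})
    (theta : Imset N -> nat) (t0 : nat) (B0 : {set N}) : Prop :=
  [/\ B0 \subset B, #|B0| = t0,
      representation A B0 C (lower_block A B C theta t0)
    & representation A (B :\: B0) (B0 :|: C) (upper_block A B C theta t0)].

Inductive sigma_decomposable (N : finType) :
    {set N} -> {set N} -> {set N} -> (Imset N -> nat) -> Prop :=
| sigma_base (A B C : {set N}) (theta : Imset N -> nat) :
    #|A| = 1%N -> #|B| = 1%N -> sigma_decomposable A B C theta
| sigma_split_A (A B C : {set N}) (theta : Imset N -> nat) (s0 : nat) (A0 : {set N}) :
    (1 <= s0 <= #|A| - 1)%N -> separable_A A B C theta s0 A0 ->
    sigma_decomposable A0 B C (left_block A B C theta s0) ->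
    sigma_decomposable (A :\: A0) B (A0 :|: C) (right_block A B C theta s0) ->
    sigma_decomposable A B C theta
| sigma_split_B (A B C : {set N}) (theta : Imset N -> nat) (t0 : nat) (B0 : {set N}) :
    (1 <= t0 <= #|B| - 1)%N -> separable_B A B C theta t0 B0 ->
    sigma_decomposable A B0 C (lower_block A B C theta t0) ->
    sigma_decomposable A (B :\: B0) (B0 :|: C) (upper_block A B C theta t0) ->
    sigma_decomposable A B C theta.

(* Main.v *)
(* Fix f, g on subsets of A and B.  Pairing an imset m with f and g, that is
   summing f(A & P) g(B & P) m(P) over P, sends u_<a,b|G> to the product of the
   increments of f and g along A & G -> a(A & G) and B & G -> b(B & G), and sends
   u_<A,B|C> to (f A - f 0)(g B - g 0).  Good choices of f and g show that a
   representation is a grid of cells u(s,t) in which every row is a maximal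
   chain of subsets of A, every column is a maximal chain of subsets of B, and
   at every interior vertex (s,t) either the two adjacent rows agree at height s
   or the two adjacent columns agree at height t.  The representation is
   (s0,* )-separable as soon as all rows agree at height s0.

   If |B| = 2 there is one interior vertex for each 0 < s < |A|: either the two
   rows agree at one of them, which gives a vertical cut, or the columns agree
   at all of them, which gives a horizontal cut.  If |A|, |B| >= 3, the 3 x 3
   corner of the grid can be tiled by five rectangles in a pinwheel, which no
   cut can cross. *)
From HB Require Import structures.
From Stdlib Require Import FunctionalExtensionality.
Require Import Defs.
From mathcomp Require Import all_boot all_order all_algebra.
From mathcomp Require Import finmap zify ring.
Set Implicit Arguments.
Unset Strict Implicit.
Unset Printing Implicit Defensive.
Import GRing.Theory Num.Theory.

Section Imsets.
Local Open Scope ring_scope.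

(** * Pairing imsets with test functions *)

Definition pairing (N : finType) (A B : {set N}) (f g : {set N} -> int)
  (m : Imset N) : int := \sum_(P : {set N}) f (A :&: P) * g (B :&: P) * m P.

Lemma pairing_is_zmod_morphism (N : finType) (A B : {set N})
  (f g : {set N} -> int) : zmod_morphism (pairing A B f g).
Proof.
move=> m1 m2; rewrite /pairing -sumrB.
by apply: eq_bigr => P _; rewrite !ffunE mulrBr.
Qed.

HB.instance Definition _ (N : finType) (A B : {set N}) (f g : {set N} -> int) :=
  GRing.isZmodMorphism.Build _ _ (pairing A B f g)
    (pairing_is_zmod_morphism A B f g).

Lemma pairing_delta (N : finType) (A B S : {set N}) (f g : {set N} -> int) :
  pairing A B f g (delta S) = f (A :&: S) * g (B :&: S).
Proof.
rewrite /pairing (bigD1 S) //= big1 => [|P /negPf nPS]; rewrite ffunE.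
  by rewrite eqxx mulr1 addr0.
by rewrite nPS mulr0.
Qed.

(** By disjointness [f] sees only whether [A'] is present and [g] only whether [B'] is, so the four
    signed terms are the expansion of a product of two differences. *)
Lemma pairing_semi_elementary (N : finType) (A B A' B' C' : {set N})
  (f g : {set N} -> int) : [disjoint A & B'] -> [disjoint B & A'] ->
  pairing A B f g (semi_elementary A' B' C') =
    (f (A :&: (A' :|: C')) - f (A :&: C')) *
    (g (B :&: (B' :|: C')) - g (B :&: C')).
Proof.
rewrite -!setI_eq0 => /eqP AB' /eqP BA'.
rewrite /semi_elementary !(raddfB, raddfD) /= !pairing_delta.
rewrite !setIUr AB' BA' setU0 !set0U; ring.
Qed.

Lemma triplesP (N : finType) (A B C : {set N}) (x : N * N * {set N}) :
  reflect [/\ x.1.1 \in A, x.1.2 \in B, C \subset x.2, x.2 \subset A :|: B :|: C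
            & (x.1.1 \notin x.2) /\ (x.1.2 \notin x.2)]
          (x \in triples A B C).
Proof.
rewrite inE subsetD disjoint_sym disjoints_subset subUset !sub1set !in_setC.
by apply: (iffP and4P) => [[? ? ? /and3P[]]|[? ? ? ? []]]; split=> //; apply/and3P.
Qed.

Lemma pairing_elementary (N : finType) (A B C : {set N}) (x : N * N * {set N})
  (f g : {set N} -> int) : [disjoint A & B] -> x \in triples A B C ->
  pairing A B f g (elementary x) =
    (f (x.1.1 |: A :&: x.2) - f (A :&: x.2)) *
    (g (x.1.2 |: B :&: x.2) - g (B :&: x.2)).
Proof.
move=> dAB /triplesP[xA xB _ _ _].
rewrite pairing_semi_elementary; last 2 first.
- by rewrite disjoint_sym disjoints1 (disjointFl dAB xB).
- by rewrite disjoint_sym disjoints1 (disjointFr dAB xA).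
rewrite !setIUr (setIidPr (_ : [set x.1.1] \subset A)) ?sub1set //.
by rewrite (setIidPr (_ : [set x.1.2] \subset B)) ?sub1set.
Qed.

Lemma pairing_semi_elementary_self (N : finType) (A B C : {set N})
  (f g : {set N} -> int) :
  [disjoint A & B] -> [disjoint A & C] -> [disjoint B & C] ->
  pairing A B f g (semi_elementary A B C) = (f A - f set0) * (g B - g set0).
Proof.
move=> dAB; rewrite -!setI_eq0 => /eqP AC /eqP BC.
rewrite pairing_semi_elementary //; last by rewrite disjoint_sym.
by rewrite !setIUr AC BC !setIid !setU0.
Qed.

(** * Layers of elementary imsets and the uniqueness of u(s,t) *)

Lemma elem_setP (N : finType) (A B C : {set N}) (u : Imset N) :
  reflect (exists2 x, x \in triples A B C & u = elementary x)
          (u \in elem_set A B C).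
Proof. by apply: (iffP (imfsetP _ _ _ _)) => -[x xABC ->]; exists x. Qed.

Lemma elem_layerP (N : finType) (A B C : {set N}) (s t : nat) (u : Imset N) :
  reflect (exists2 x, [/\ x \in triples A B C, #|A :&: x.2| = s & #|B :&: x.2| = t]
                    & u = elementary x)
          (u \in elem_layer A B C s t).
Proof.
apply: (iffP (imfsetP _ _ _ _)) => -[x].
  by rewrite inE /= => /and3P[? /eqP ? /eqP ?]; exists x.
by case=> xABC <- <- ->; exists x => //; rewrite inE /= xABC !eqxx.
Qed.

(* Takes the value 1 on the elements of E^{s,t}_<A,B|C> and 0 on the other
   elements of E_<A,B|C>. *)
Definition layer_index (N : finType) (A B : {set N}) (s t : nat) : Imset N -> int :=
  pairing A B (fun S => (#|S| <= s)%N%:R) (fun T => (#|T| <= t)%N%:R).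

Lemma leq_indicator_diff (k s : nat) :
  (k < s)%N%:R - (k <= s)%N%:R = - (k == s)%:R :> int.
Proof. by case: ltngtP. Qed.

(** Adding one element to a set changes a threshold indicator only when the set has exactly the
    threshold size, and then by -1; the two signs cancel. *)
Lemma layer_index_elementary (N : finType) (A B C : {set N}) (s t : nat)
  (x : N * N * {set N}) : [disjoint A & B] -> x \in triples A B C ->
  layer_index A B s t (elementary x) =
    ((#|A :&: x.2| == s) && (#|B :&: x.2| == t))%:R.
Proof.
move=> dAB xABC; rewrite /layer_index (pairing_elementary _ _ dAB xABC).
case/triplesP: xABC => _ _ _ _ [a1 b1].
rewrite !cardsU1 !inE (negPf a1) (negPf b1) !andbF !add1n.
rewrite !leq_indicator_diff mulrNN -natrM mulnb //.
Qed.

(** Layer membership only asks for some index triple. As [layer_index] depends on the imset alone,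
    all triples that name the same imset agree on the layer. *)
Lemma elem_layer_index (N : finType) (A B C : {set N}) (s t : nat) (u : Imset N) :
  [disjoint A & B] -> u \in elem_set A B C ->
  layer_index A B s t u = (u \in elem_layer A B C s t)%:R.
Proof.
move=> dAB /elem_setP[x xABC ->]; rewrite (layer_index_elementary _ _ dAB xABC).
congr (_%:R); congr nat_of_bool; apply/idP/idP => [/andP[/eqP <- /eqP <-]|].
  by apply/elem_layerP; exists x.
case/elem_layerP=> y [yABC cA cB] /(congr1 (layer_index A B s t)).
rewrite (layer_index_elementary _ _ dAB xABC) (layer_index_elementary _ _ dAB yABC).
by rewrite cA cB !eqxx; case: andP.
Qed.

Lemma elem_layer_sub (N : finType) (A B C : {set N}) (s t : nat) (u : Imset N) :
  u \in elem_layer A B C s t -> u \in elem_set A B C.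
Proof. by case/elem_layerP=> x [xABC _ _ ->]; apply/elem_setP; exists x. Qed.

Lemma elem_layer_inj (N : finType) (A B C : {set N}) (s t s' t' : nat)
  (u : Imset N) : [disjoint A & B] -> u \in elem_layer A B C s t ->
  u \in elem_layer A B C s' t' -> s = s' /\ t = t'.
Proof.
move=> dAB us; have uE := elem_layer_sub us.
case/elem_layerP=> x [xABC <- <-] def_u; move: us.
have := elem_layer_index s t dAB uE.
rewrite def_u (layer_index_elementary _ _ dAB xABC) => ei us; move: ei.
by rewrite us; do 2!case: eqP => [<-|] //.
Qed.

Lemma elem_layer_index_bounds (N : finType) (A B C : {set N}) (s t : nat)
  (u : Imset N) : u \in elem_layer A B C s t -> (s < #|A|)%N /\ (t < #|B|)%N.
Proof.
case/elem_layerP=> x [/triplesP[xA xB _ _ [nA nB]] <- <-] _; split.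
  apply: proper_card; apply/properP; split; first exact: subsetIl.
  by exists x.1.1; rewrite // inE xA (negPf nA).
apply: proper_card; apply/properP; split; first exact: subsetIl.
by exists x.1.2; rewrite // inE xB (negPf nB).
Qed.

(** Apply [layer_index] to both sides of the representation: the left gives (0 - 1)(0 - 1) = 1, the
    right adds up the coefficients in the layer. *)
Lemma representation_layer (N : finType) (A B C : {set N}) (theta : Imset N -> nat)
  (s t : nat) : [disjoint A & B] -> [disjoint A & C] -> [disjoint B & C] ->
  representation A B C theta -> (s < #|A|)%N -> (t < #|B|)%N ->
  (\sum_(u <- elem_layer A B C s t) theta u = 1)%N.
Proof.
move=> dAB dAC dBC [_ rep] sA tB.
have := congr1 (layer_index A B s t) rep.
rewrite {1}/layer_index pairing_semi_elementary_self // !cards0.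
rewrite [(#|A| <= s)%N]leqNgt sA [(#|B| <= t)%N]leqNgt tB /= !sub0r mulrNN mulr1.
rewrite /layer_index raddf_sum /=.
under eq_big_seq => u uE.
  rewrite raddfMn /= -/(layer_index _ _ _ _ _) (elem_layer_index _ _ dAB uE).
  rewrite -mulrnA. over.
rewrite -natr_sum => /esym/eqP; rewrite (eqr_nat _ _ 1) => /eqP <-.
under [RHS]eq_bigr do rewrite mulnbl.
rewrite -big_mkcond -[RHS]big_filter; apply: perm_big.
apply: uniq_perm; rewrite ?filter_uniq ?fset_uniq // => u.
by rewrite mem_filter; case: (boolP (u \in elem_layer _ _ _ _ _)) => // /elem_layer_sub ->.
Qed.

Lemma rep_atP (N : finType) (A B C : {set N}) (theta : Imset N -> nat)
  (s t : nat) : [disjoint A & B] -> [disjoint A & C] -> [disjoint B & C] ->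
  representation A B C theta -> (s < #|A|)%N -> (t < #|B|)%N ->
  rep_at A B C theta s t \in elem_layer A B C s t /\
  {in elem_layer A B C s t, forall u, theta u = (u == rep_at A B C theta s t)}.
Proof.
move=> dAB dAC dBC rep sA tB.
have := representation_layer dAB dAC dBC rep sA tB.
case/sum_nat_seq_eq1=> u0 [u0L _ th0 thN].
suff -> : rep_at A B C theta s t = u0.
  by split=> // u uL; case: eqP => [-> //|/eqP nu]; apply: thN.
(* The filtered list contains [u0], so its head is not the default; that head has coefficient 1 and
   hence equals [u0]. *)
rewrite /rep_at; set l := filter _ _.
have: u0 \in l by rewrite mem_filter th0 eqxx.
case def_l: l => [|u l'] //= _.
have: u \in l by rewrite def_l mem_head.
rewrite mem_filter => /andP[/eqP thu uL].
by apply/eqP/contraT => nu; move: thu; rewrite thN.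
Qed.

(** Both sides vanish outside E. An imset of E lies in a single layer, so at most one term of the
    double sum survives, and its value is the coefficient. *)
Lemma representation_block (N : finType) (A B C : {set N})
  (theta : Imset N -> nat) :
  [disjoint A & B] -> [disjoint A & C] -> [disjoint B & C] ->
  representation A B C theta ->
  block A B C theta 0 #|A| 0 #|B| =1 theta.
Proof.
move=> dAB dAC dBC rep u; rewrite /block.
have [uE|nuE] := boolP (u \in elem_set A B C); last first.
  rewrite (proj1 rep _ nuE) big_nat big1 // => s /andP[_ sA].
  rewrite big_nat big1 // => t /andP[_ tB].
  have [uL _] := rep_atP dAB dAC dBC rep sA tB.
  by case: eqP nuE => // ->; rewrite (elem_layer_sub uL).
have [x xABC def_u] := elem_setP _ _ _ _ uE.
set s0 := #|A :&: x.2|; set t0 := #|B :&: x.2|.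
have uL: u \in elem_layer A B C s0 t0 by apply/elem_layerP; exists x.
have [s0A t0B] := elem_layer_index_bounds uL.
have nL s t : (s < #|A|)%N -> (t < #|B|)%N -> (s, t) != (s0, t0) ->
    (u == rep_at A B C theta s t) = false.
  move=> sA tB nst; have [uL' _] := rep_atP dAB dAC dBC rep sA tB.
  apply/eqP => eu; rewrite -eu in uL'.
  by have [es et] := elem_layer_inj dAB uL uL'; rewrite -es -et eqxx in nst.
rewrite big_mkord (bigD1 (Ordinal s0A)) //= big_mkord (bigD1 (Ordinal t0B)) //=.
have [_ ->] := rep_atP dAB dAC dBC rep s0A t0B; last by [].
rewrite big1 => [|t nt]; last by rewrite nL // xpair_eqE eqxx.
rewrite big1 ?addn0 // => s ns; rewrite big_nat big1 // => t /andP[_ tB].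
by rewrite nL // xpair_eqE negb_and (ns : _ != s0 :> nat).
Qed.

Lemma sum_block (N : finType) (A B C : {set N}) (theta : Imset N -> nat)
  (s1 s2 t1 t2 : nat) (E : {fset Imset N}) :
  (forall s t, (s1 <= s < s2)%N -> (t1 <= t < t2)%N ->
     rep_at A B C theta s t \in E) ->
  \sum_(u <- E) u *+ block A B C theta s1 s2 t1 t2 u =
  \sum_(s1 <= s < s2) \sum_(t1 <= t < t2) rep_at A B C theta s t.
Proof.
move=> inE; rewrite /block.
under eq_bigr do rewrite -sumrMnr.
rewrite exchange_big /= big_nat [RHS]big_nat; apply: eq_bigr => s sI.
under eq_bigr do rewrite -sumrMnr.
rewrite exchange_big /= big_nat [RHS]big_nat; apply: eq_bigr => t tI.
rewrite (bigD1_seq (rep_at A B C theta s t)) ?fset_uniq ?inE //=.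
rewrite eqxx mulr1n big1 ?addr0 // => u /negPf ->.
by rewrite mulr0n.
Qed.

(** * The grid of a representation *)

(** A choice of index triples (a,b,G) for the imsets u(s,t), giving access to the sets [A :&: G] and
    [B :&: G]. Values of [x] outside the rectangle are arbitrary. *)
Definition grid (N : finType) (A B C : {set N}) (theta : Imset N -> nat)
  (x : nat -> nat -> N * N * {set N}) : Prop :=
  forall s t, (s < #|A|)%N -> (t < #|B|)%N ->
  [/\ x s t \in triples A B C, #|A :&: (x s t).2| = s, #|B :&: (x s t).2| = t
    & rep_at A B C theta s t = elementary (x s t)].

Lemma grid_exists (N : finType) (A B C : {set N}) (theta : Imset N -> nat) :
  [disjoint A & B] -> [disjoint A & C] -> [disjoint B & C] ->
  A != set0 -> B != set0 -> representation A B C theta ->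
  exists x, grid A B C theta x.
Proof.
move=> dAB dAC dBC /set0Pn[a aA] /set0Pn[b bB] rep.
pose P s t (y : N * N * {set N}) := [&& y \in triples A B C, #|A :&: y.2| == s,
  #|B :&: y.2| == t & rep_at A B C theta s t == elementary y].
(* The default [(a, b, C)] is never reached inside the rectangle, by [rep_atP]. *)
exists (fun s t => odflt (a, b, C) [pick y | P s t y]) => s t sA tB.
case: pickP => [y /and4P[? /eqP ? /eqP ? /eqP ?] //|nP].
have [/elem_layerP[y [y1 y2 y3] y4] _] := rep_atP dAB dAC dBC rep sA tB.
by have := nP y; rewrite /P y1 y2 y3 y4 !eqxx.
Qed.

Lemma grid_sum (N : finType) (A B C : {set N}) (theta : Imset N -> nat)
  (x : nat -> nat -> N * N * {set N}) :
  [disjoint A & B] -> [disjoint A & C] -> [disjoint B & C] ->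
  representation A B C theta -> grid A B C theta x ->
  semi_elementary A B C =
    \sum_(0 <= s < #|A|) \sum_(0 <= t < #|B|) elementary (x s t).
Proof.
move=> dAB dAC dBC rep gx; rewrite (proj2 rep).
under eq_bigr => u _ do rewrite -(representation_block dAB dAC dBC rep).
rewrite sum_block => [|s t /andP[_ sA] /andP[_ tB]]; last first.
  by have [uL _] := rep_atP dAB dAC dBC rep sA tB; apply: elem_layer_sub uL.
apply: eq_big_nat => s /andP[_ sA]; apply: eq_big_nat => t /andP[_ tB].
by have [_ _ _ ->] := gx s t sA tB.
Qed.

Lemma grid_pairing (N : finType) (A B C : {set N}) (theta : Imset N -> nat)
  (x : nat -> nat -> N * N * {set N}) (f g : {set N} -> int) :
  [disjoint A & B] -> [disjoint A & C] -> [disjoint B & C] ->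
  representation A B C theta -> grid A B C theta x ->
  (f A - f set0) * (g B - g set0) =
    \sum_(0 <= s < #|A|) \sum_(0 <= t < #|B|)
      (f ((x s t).1.1 |: A :&: (x s t).2) - f (A :&: (x s t).2)) *
      (g ((x s t).1.2 |: B :&: (x s t).2) - g (B :&: (x s t).2)).
Proof.
move=> dAB dAC dBC rep gx.
rewrite -(pairing_semi_elementary_self f g dAB dAC dBC).
rewrite (grid_sum dAB dAC dBC rep gx) raddf_sum.
apply: eq_big_nat => s /andP[_ sA]; rewrite raddf_sum.
apply: eq_big_nat => t /andP[_ tB].
by have [xABC _ _ _] := gx s t sA tB; rewrite /= (pairing_elementary _ _ dAB xABC).
Qed.

Lemma grid_card (N : finType) (A B C : {set N}) (theta : Imset N -> nat)
  (x : nat -> nat -> N * N * {set N}) (s t : nat) :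
  grid A B C theta x -> (s < #|A|)%N -> (t < #|B|)%N ->
  #|(x s t).1.1 |: A :&: (x s t).2| = s.+1 /\
  #|(x s t).1.2 |: B :&: (x s t).2| = t.+1.
Proof.
move=> gx sA tB; have [/triplesP[_ _ _ _ [na nb]] cs ct _] := gx s t sA tB.
by rewrite !cardsU1 !inE (negPf na) (negPf nb) !andbF cs ct.
Qed.

Lemma big_nat_pair (s n : nat) (F : nat -> int) : (s.+1 < n)%N ->
  (forall i, (i < n)%N -> i != s -> i != s.+1 -> F i = 0) ->
  \sum_(0 <= i < n) F i = F s + F s.+1.
Proof.
move=> sn F0; have s'n := ltnW sn.
rewrite big_mkord (bigD1 (Ordinal s'n)) //= (bigD1 (Ordinal sn)) /=; last first.
  by rewrite -val_eqE /= eqn_leq ltnn.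
by rewrite big1 ?addr0 // => i /andP[]; rewrite -!val_eqE /= => *; apply: F0.
Qed.

Lemma eq_set_card_neq (N : finType) (S U : {set N}) (k : nat) :
  #|U| = k -> #|S| != k -> (S == U) = false.
Proof. by move=> <- nk; apply: contraNF nk => /eqP ->. Qed.

(** Test with the indicator of [U], the upper A-set of cell (s,t), and with a threshold at t, which
    isolates row t. The total is 0, cell (s,t) enters [U], and by cardinality only cell (s+1,t) can
    leave it. *)
Lemma row_chain (N : finType) (A B C : {set N}) (theta : Imset N -> nat)
  (x : nat -> nat -> N * N * {set N}) (s t : nat) :
  [disjoint A & B] -> [disjoint A & C] -> [disjoint B & C] ->
  representation A B C theta -> grid A B C theta x ->
  (s.+1 < #|A|)%N -> (t < #|B|)%N ->
  A :&: (x s.+1 t).2 = (x s t).1.1 |: A :&: (x s t).2.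
Proof.
move=> dAB dAC dBC rep gx sA tB.
have [cU _] := grid_card gx (ltnW sA) tB.
move: cU; set U := (_ |: _) => cU.
pose f (S : {set N}) : int := (S == U)%:R.
pose g (T : {set N}) : int := (#|T| <= t)%N%:R.
have := grid_pairing f g dAB dAC dBC rep gx.
(* [U] has size s+1, strictly between 0 and the size of [A], so the left-hand side vanishes. *)
have -> : f A = 0 by rewrite /f (eq_set_card_neq cU) // neq_ltn sA orbT.
have -> : f set0 = 0 by rewrite /f (eq_set_card_neq cU) // cards0.
rewrite subrr mul0r.
(* The minus sign is the increment -1 of [g] on row t. *)
pose F s' := - (f ((x s' t).1.1 |: A :&: (x s' t).2) - f (A :&: (x s' t).2)).
rewrite (@eq_big_nat _ _ _ _ _ _ F) => [|s' /andP[_ s'A]]; last first.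
  rewrite big_mkord (bigD1 (Ordinal tB)) //= big1 => [|t' nt].
    have [_ _ ct _] := gx s' t s'A tB; have [_ ct'] := grid_card gx s'A tB.
    by rewrite /g ct ct' ltnn leqnn addr0 sub0r mulrN1.
  have [_ _ ct _] := gx s' t' s'A (ltn_ord t').
  have [_ ct'] := grid_card gx s'A (ltn_ord t').
  rewrite /g ct ct' leq_indicator_diff.
  by rewrite [(_ == t)%N](negPf nt : _ = false) oppr0 mulr0.
rewrite (@big_nat_pair s) // /F => [|i iA nis nis']; last first.
  have [_ ci _ _] := gx i t iA tB; have [ci' _] := grid_card gx iA tB.
  by rewrite /f !(eq_set_card_neq cU) ?ci ?ci' ?subrr ?oppr0.
have [_ c1 _ _] := gx s t (ltnW sA) tB.
have [_ c2 _ _] := gx s.+1 t sA tB; have [c3 _] := grid_card gx sA tB.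
rewrite /f -/U eqxx (@eq_set_card_neq _ (A :&: (x s t).2) U s.+1) ?c1 //; last first.
  by rewrite neq_ltn leqnn.
rewrite (@eq_set_card_neq _ (_ |: _) U s.+1) ?c3 //; last by rewrite neq_ltn leqnn orbT.
by case: eqP.
Qed.

(** * Exchanging the roles of A and B *)

Definition swap (N : finType) (x : N * N * {set N}) : N * N * {set N} :=
  (x.1.2, x.1.1, x.2).

Lemma semi_elementaryC (N : finType) (A B C : {set N}) :
  semi_elementary A B C = semi_elementary B A C.
Proof. by rewrite /semi_elementary (setUC A B) -!addrA (addrC (- delta _)). Qed.

Lemma elementary_swap (N : finType) (x : N * N * {set N}) :
  elementary (swap x) = elementary x.
Proof. exact: semi_elementaryC. Qed.

Lemma swap_triples (N : finType) (A B C : {set N}) (x : N * N * {set N}) :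
  x \in triples A B C -> swap x \in triples B A C.
Proof. by case/triplesP=> *; apply/triplesP; rewrite (setUC B A); split=> //; split; tauto. Qed.

Lemma elem_setC (N : finType) (A B C : {set N}) :
  elem_set A B C = elem_set B A C.
Proof.
apply/fsetP => u; apply/elem_setP/elem_setP => -[x xABC ->].
  by exists (swap x); rewrite ?swap_triples ?elementary_swap.
by exists (swap x); rewrite ?swap_triples ?elementary_swap.
Qed.

Lemma elem_layerC (N : finType) (A B C : {set N}) (s t : nat) :
  elem_layer A B C s t = elem_layer B A C t s.
Proof.
apply/fsetP => u; apply/elem_layerP/elem_layerP => -[x [xABC cA cB] ->].
  by exists (swap x); rewrite ?swap_triples ?elementary_swap.
by exists (swap x); rewrite ?swap_triples ?elementary_swap.
Qed.

Lemma representationC (N : finType) (A B C : {set N}) (theta : Imset N -> nat) :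
  representation A B C theta -> representation B A C theta.
Proof. by rewrite /representation elem_setC semi_elementaryC. Qed.

Lemma rep_atC (N : finType) (A B C : {set N}) (theta : Imset N -> nat) (s t : nat) :
  rep_at A B C theta s t = rep_at B A C theta t s.
Proof. by rewrite /rep_at elem_layerC. Qed.

(** The equality is between functions, not pointwise, because it is used to rewrite the coefficient
    vector, an index of [sigma_decomposable]. *)
Lemma blockC (N : finType) (A B C : {set N}) (theta : Imset N -> nat)
  (s1 s2 t1 t2 : nat) :
  block A B C theta s1 s2 t1 t2 = block B A C theta t1 t2 s1 s2.
Proof.
apply: functional_extensionality => u; rewrite /block exchange_big /=.
by apply: eq_bigr => t _; apply: eq_bigr => s _; rewrite rep_atC.
Qed.

Lemma separable_AC (N : finType) (A B C : {set N}) (theta : Imset N -> nat)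
  (s0 : nat) (A0 : {set N}) :
  separable_A A B C theta s0 A0 <-> separable_B B A C theta s0 A0.
Proof.
rewrite /separable_A /separable_B /left_block /right_block /lower_block /upper_block.
rewrite !(blockC A B).
by split=> -[? ? ? ?]; split=> //; apply: representationC.
Qed.

Lemma sigma_decomposableC (N : finType) (A B C : {set N}) (theta : Imset N -> nat) :
  sigma_decomposable A B C theta -> sigma_decomposable B A C theta.
Proof.
elim=> {A B C theta}.
- by move=> A B C theta cA cB; apply: sigma_base.
- move=> A B C theta s0 A0 s0A sep _ IHl _ IHr.
  apply: (@sigma_split_B _ _ _ _ _ s0 A0) => //; first exact/separable_AC.
    by rewrite /lower_block -blockC.
  by rewrite /upper_block -blockC.
- move=> A B C theta t0 B0 t0B sep _ IHl _ IHr.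
  apply: (@sigma_split_A _ _ _ _ _ t0 B0) => //; first exact/separable_AC.
    by rewrite /left_block -blockC.
  by rewrite /right_block -blockC.
Qed.

Lemma grid_swap (N : finType) (A B C : {set N}) (theta : Imset N -> nat)
  (x : nat -> nat -> N * N * {set N}) :
  grid A B C theta x -> grid B A C theta (fun t s => swap (x s t)).
Proof.
move=> gx t s tB sA; have [? ? ? e] := gx s t sA tB.
by split=> //; rewrite ?swap_triples // elementary_swap rep_atC.
Qed.

Lemma column_chain (N : finType) (A B C : {set N}) (theta : Imset N -> nat)
  (x : nat -> nat -> N * N * {set N}) (s t : nat) :
  [disjoint A & B] -> [disjoint A & C] -> [disjoint B & C] ->
  representation A B C theta -> grid A B C theta x ->
  (s < #|A|)%N -> (t.+1 < #|B|)%N ->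
  B :&: (x s t.+1).2 = (x s t).1.2 |: B :&: (x s t).2.
Proof.
rewrite disjoint_sym => dAB dAC dBC rep gx sA tB.
exact: (row_chain dAB dBC dAC (representationC rep) (grid_swap gx)).
Qed.

(** Test with the indicators of [U], the set of the lower row at height s+1, and of [V], the set of
    the left column at height t+1. By cardinality only the four cells around the vertex
    contribute. *)
Lemma interior_vertex (N : finType) (A B C : {set N}) (theta : Imset N -> nat)
  (x : nat -> nat -> N * N * {set N}) (s t : nat) :
  [disjoint A & B] -> [disjoint A & C] -> [disjoint B & C] ->
  representation A B C theta -> grid A B C theta x ->
  (s.+1 < #|A|)%N -> (t.+1 < #|B|)%N ->
  A :&: (x s.+1 t.+1).2 = A :&: (x s.+1 t).2 \/
  B :&: (x s.+1 t.+1).2 = B :&: (x s t.+1).2.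
Proof.
move=> dAB dAC dBC rep gx sA tB.
have [sA' tB'] := (ltnW sA, ltnW tB).
have [_ cU _ _] := gx s.+1 t sA tB'; have [_ _ cV _] := gx s t.+1 sA' tB.
move: cU cV; set U := A :&: (x s.+1 t).2; set V := B :&: (x s t.+1).2 => cU cV.
pose f (S : {set N}) : int := (S == U)%:R.
pose g (T : {set N}) : int := (T == V)%:R.
have := grid_pairing f g dAB dAC dBC rep gx.
have -> : f A = 0 by rewrite /f (eq_set_card_neq cU) // neq_ltn sA orbT.
have -> : f set0 = 0 by rewrite /f (eq_set_card_neq cU) // cards0.
rewrite subrr mul0r.
pose df i j := f ((x i j).1.1 |: A :&: (x i j).2) - f (A :&: (x i j).2).
pose dg i j := g ((x i j).1.2 |: B :&: (x i j).2) - g (B :&: (x i j).2).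
rewrite -/(\sum_(0 <= i < #|A|) \sum_(0 <= j < #|B|) df i j * dg i j).
have df0 i j : (i < #|A|)%N -> (j < #|B|)%N -> i != s -> i != s.+1 -> df i j = 0.
  move=> iA jB nis nis'; have [_ ci _ _] := gx i j iA jB.
  have [ci' _] := grid_card gx iA jB.
  by rewrite /df /f !(eq_set_card_neq cU) ?ci ?ci' ?subrr.
have dg0 i j : (i < #|A|)%N -> (j < #|B|)%N -> j != t -> j != t.+1 -> dg i j = 0.
  move=> iA jB nit nit'; have [_ _ cj _] := gx i j iA jB.
  have [_ cj'] := grid_card gx iA jB.
  by rewrite /dg /g !(eq_set_card_neq cV) ?cj ?cj' ?subrr.
rewrite (@big_nat_pair s) // => [|i iA nis nis']; last first.
  by rewrite big_nat big1 // => j /andP[_ jB]; rewrite df0 // mul0r.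
rewrite !(@big_nat_pair t) // => [|j jB njt njt'|j jB njt njt']; last 2 first.
- by rewrite dg0 ?mulr0.
- by rewrite dg0 ?mulr0.
have df_low j : (j < #|B|)%N -> df s j = (A :&: (x s.+1 j).2 == U)%:R.
  move=> jB; have [_ cj _ _] := gx s j sA' jB.
  rewrite /df /f -(row_chain dAB dAC dBC rep gx) //.
  rewrite (@eq_set_card_neq _ (A :&: (x s j).2) U s.+1) ?cj ?subr0 //.
  by rewrite neq_ltn leqnn.
have df_high j : (j < #|B|)%N -> df s.+1 j = - (A :&: (x s.+1 j).2 == U)%:R.
  move=> jB; have [cj _] := grid_card gx sA jB.
  rewrite /df /f (@eq_set_card_neq _ (_ |: _) U s.+1) ?cj ?sub0r //.
  by rewrite neq_ltn leqnn orbT.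
have dg_low i : (i < #|A|)%N -> dg i t = (B :&: (x i t.+1).2 == V)%:R.
  move=> iA; have [_ _ ci _] := gx i t iA tB'.
  rewrite /dg /g -(column_chain dAB dAC dBC rep gx) //.
  rewrite (@eq_set_card_neq _ (B :&: (x i t).2) V t.+1) ?ci ?subr0 //.
  by rewrite neq_ltn leqnn.
have dg_high i : (i < #|A|)%N -> dg i t.+1 = - (B :&: (x i t.+1).2 == V)%:R.
  move=> iA; have [_ ci] := grid_card gx iA tB.
  rewrite /dg /g (@eq_set_card_neq _ (_ |: _) V t.+1) ?ci ?sub0r //.
  by rewrite neq_ltn leqnn orbT.
(* With p and q the truth values of the two alternatives, the four terms are 1 - p - q + pq = (1 -
   p)(1 - q), which must be 0. *)
rewrite !df_low // !df_high // !dg_low // !dg_high // -/U -/V !eqxx.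
by case: eqP; case: eqP; auto.
Qed.

(** * Separability and the thin case *)

Lemma row_mono (N : finType) (A B C : {set N}) (theta : Imset N -> nat)
  (x : nat -> nat -> N * N * {set N}) (s s' t : nat) :
  [disjoint A & B] -> [disjoint A & C] -> [disjoint B & C] ->
  representation A B C theta -> grid A B C theta x ->
  (s < s' < #|A|)%N -> (t < #|B|)%N ->
  (x s t).1.1 |: A :&: (x s t).2 \subset A :&: (x s' t).2.
Proof.
move=> dAB dAC dBC rep gx + tB; elim: s' => // s' IH /andP[].
rewrite ltnS leq_eqVlt => /orP[/eqP <-|ss'] s'A.
  by rewrite -(row_chain dAB dAC dBC rep gx).
apply: (subset_trans (IH _)); first by rewrite ss' ltnW.
by rewrite (row_chain dAB dAC dBC rep gx s'A tB) subsetUr.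
Qed.

(** The points [A0 :|: C] and [A0 :|: B :|: C] occur on the right with opposite signs and cancel. *)
Lemma semi_elementaryU (N : finType) (A0 A1 B C : {set N}) :
  semi_elementary (A0 :|: A1) B C =
  semi_elementary A0 B C + semi_elementary A1 B (A0 :|: C).
Proof.
rewrite /semi_elementary.
rewrite (_ : A1 :|: B :|: (A0 :|: C) = A0 :|: A1 :|: B :|: C); last first.
  by rewrite (setUC A0 A1) !setUA -!(setUAC _ A0).
rewrite (_ : A1 :|: (A0 :|: C) = A0 :|: A1 :|: C); last by rewrite setUA (setUC A1).
rewrite (_ : B :|: (A0 :|: C) = A0 :|: B :|: C); last by rewrite setUA (setUC B).
by apply/ffunP => P; rewrite !ffunE; ring.
Qed.

Lemma semi_elementary_support (N : finType) (A B C P : {set N}) :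
  semi_elementary A B C P != 0 -> C \subset P /\ P \subset A :|: B :|: C.
Proof.
rewrite !ffunE; have [->|_] := eqVneq P (A :|: B :|: C); first by rewrite subsetUr.
have [->|_] := eqVneq P C; first by rewrite subsetUr.
have [->|_] := eqVneq P (A :|: C); first by rewrite subsetUr setSU ?subsetUl.
have [->|_] := eqVneq P (B :|: C); first by rewrite subsetUr setSU ?subsetUr.
by [].
Qed.

Lemma elementary_support (N : finType) (A B C P : {set N}) (x : N * N * {set N}) :
  x \in triples A B C -> elementary x P != 0 ->
  C \subset P /\ P \subset A :|: B :|: C.
Proof.
case/triplesP=> xA xB Cx xU _ /semi_elementary_support[xP Px].
split; first exact: subset_trans xP.
apply: (subset_trans Px); rewrite !subUset xU !sub1set !inE xA xB.
by rewrite orbT.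
Qed.

Lemma imsetB (N : finType) (m1 m2 : Imset N) (P : {set N}) :
  (m1 - m2) P = m1 P - m2 P.
Proof. by rewrite !ffunE. Qed.

(* L - u_<A0,B|C> is supported on the sets P with A & P = A0, hence equal there
   to its own marginal on B, which vanishes. *)
Lemma semi_elementary_left (N : finType) (A A0 B C : {set N}) (L R : Imset N) :
  [disjoint A & B] -> [disjoint A & C] -> A0 \subset A ->
  (forall P, L P != 0 -> C \subset P /\ P \subset A0 :|: B :|: C) ->
  (forall P, R P != 0 -> A0 :|: C \subset P /\ P \subset A :|: B :|: C) ->
  (forall g, pairing A B (fun=> 1) g L = 0) ->
  semi_elementary A B C = L + R -> semi_elementary A0 B C = L.
Proof.
move=> dAB dAC A0A sL sR marg eLR.
pose D : Imset N := L - semi_elementary A0 B C.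
(* The definition of [D] bounds its support from above by [A0 :|: B :|: C], this second form from
   below by [A0 :|: C]. *)
have D_eq : D = semi_elementary (A :\: A0) B (A0 :|: C) - R.
  move: eLR; rewrite -{1}(setID A A0) semi_elementaryU (setIidPr A0A) => e.
  by rewrite /D -[L](addrK R) -e addrAC (addrC (semi_elementary A0 B C)) addrK.
have sD P : D P != 0 -> P = A0 :|: C :|: B :&: P.
  move=> DP.
  have [CP PA0] : C \subset P /\ P \subset A0 :|: B :|: C.
    move: DP; rewrite imsetB subr_eq0.
    have [L0|/sL //] := eqVneq (L P) 0.
    by rewrite L0 eq_sym => /semi_elementary_support.
  have A0CP : A0 :|: C \subset P.
    move: DP; rewrite D_eq imsetB subr_eq0.
    have [R0|/sR[] //] := eqVneq (R P) 0.
    by rewrite R0 => /semi_elementary_support[].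
  apply/eqP; rewrite eqEsubset; apply/andP; split; last first.
    by rewrite subUset A0CP subsetIr.
  apply/subsetP => z zP; have := subsetP PA0 z zP.
  by rewrite !inE zP andbT; case: (z \in A0) (z \in B) (z \in C) => [] [] [].
apply/esym/eqP; rewrite -subr_eq0; apply/eqP/ffunP => P; rewrite [RHS]ffunE.
apply/eqP/contraT => DP.
(* On the support of [D] a set is determined by its trace on [B], so this test function reads off
   the single value [D P]. *)
have : pairing A B (fun=> 1) (fun T => (T == B :&: P)%:R) D = 0.
  rewrite /D raddfB /= marg pairing_semi_elementary //; last first.
    by rewrite disjoint_sym; apply: disjointWl A0A dAB.
  by rewrite subrr mul0r subr0.
rewrite /pairing (bigD1 P) //= big1 => [|Q nQP].
  by rewrite eqxx !mul1r addr0 => /eqP; rewrite (negPf DP).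
have [->|DQ] := eqVneq (D Q) 0; first by rewrite mulr0.
case: eqP => [eBQ|_]; last by rewrite mulr0 mul0r.
by rewrite (sD _ DQ) eBQ -(sD _ DP) eqxx in nQP.
Qed.

Lemma sum_neq0P (I : eqType) (r : seq I) (F : I -> int) :
  \sum_(i <- r) F i != 0 -> exists2 i, i \in r & F i != 0.
Proof.
elim: r => [|i r IH]; first by rewrite big_nil eqxx.
rewrite big_cons; have [-> | Fi _] := eqVneq (F i) 0; last by exists i; rewrite ?mem_head.
by rewrite add0r => /IH[j jr Fj]; exists j => //; rewrite in_cons jr orbT.
Qed.

Lemma grid_sum_support (N : finType) (A B C P : {set N})
  (x : nat -> nat -> N * N * {set N}) (s1 s2 t2 : nat) :
  (forall s t, (s1 <= s < s2)%N -> (t < t2)%N -> x s t \in triples A B C) ->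
  (\sum_(s1 <= s < s2) \sum_(0 <= t < t2) elementary (x s t)) P != 0 ->
  C \subset P /\ P \subset A :|: B :|: C.
Proof.
move=> xABC; rewrite sum_ffunE => /sum_neq0P[s].
rewrite mem_index_iota sum_ffunE => sI /sum_neq0P[t].
rewrite mem_index_iota => tI; apply: elementary_support; exact: xABC.
Qed.

(** Rows are chains through [A0] at height s0, so cells to the left stay inside [A0] and cells to
    the right contain it. The supports then let [semi_elementary_left] identify the left sum; the
    right one follows by subtraction. *)
Lemma separable_criterion (N : finType) (A B C : {set N}) (theta : Imset N -> nat)
  (x : nat -> nat -> N * N * {set N}) (s0 : nat) (A0 : {set N}) :
  [disjoint A & B] -> [disjoint A & C] -> [disjoint B & C] ->
  representation A B C theta -> grid A B C theta x ->
  (0 < s0 < #|A|)%N -> B != set0 ->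
  (forall t, (t < #|B|)%N -> A :&: (x s0 t).2 = A0) ->
  separable_A A B C theta s0 A0.
Proof.
move=> dAB dAC dBC rep gx /andP[s0_gt0 s0A]; rewrite -card_gt0 => B0 eA0.
have A0A : A0 \subset A by rewrite -(eA0 0) // subsetIl.
have xl s t : (0 <= s < s0)%N -> (t < #|B|)%N -> x s t \in triples A0 B C.
  move=> /= ss0 tB; have sA := ltn_trans ss0 s0A.
  have [/triplesP[xA xB Cx xU nx] _ _ _] := gx s t sA tB.
  have := @row_mono _ _ _ _ _ _ s s0 t dAB dAC dBC rep gx.
  rewrite ss0 s0A eA0 // subUset sub1set => /(_ isT tB)/andP[xA0 A0x].
  apply/triplesP; split=> //; apply/subsetP => z zx; have := subsetP xU z zx.
  have := subsetP A0x z; rewrite !inE zx andbT.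
  by case: (z \in A) => [/(_ isT) -> //|_ /= ]; rewrite -orbA => ->; rewrite orbT.
have xr s t : (s0 <= s < #|A|)%N -> (t < #|B|)%N ->
    x s t \in triples (A :\: A0) B (A0 :|: C).
  move=> /andP[s0s sA] tB.
  have [/triplesP[xA xB Cx xU nx] _ _ _] := gx s t sA tB.
  have A0x : A0 \subset (x s t).2.
    move: s0s; rewrite leq_eqVlt => /orP[/eqP <-|s0s]; first by rewrite -(eA0 t) // subsetIr.
    rewrite -(eA0 t) //; apply: subset_trans (subsetIr A _).
    apply: subset_trans (row_mono dAB dAC dBC rep gx _ tB); first exact: subsetUr.
    by rewrite s0s.
  apply/triplesP; split=> //.
  - rewrite inE xA andbT; apply: contra nx.1; exact: (subsetP A0x).
  - by rewrite subUset A0x.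
  apply/subsetP => z zx; have := subsetP xU z zx; rewrite !inE.
  by case: (z \in A0) => //=; rewrite ?orbT.
have repE s t sA tB := let: And4 _ _ _ e := gx s t sA tB in e.
pose L := \sum_(0 <= s < s0) \sum_(0 <= t < #|B|) elementary (x s t).
pose R := \sum_(s0 <= s < #|A|) \sum_(0 <= t < #|B|) elementary (x s t).
have eLR : semi_elementary A B C = L + R.
  by rewrite (grid_sum dAB dAC dBC rep gx) (big_cat_nat (n := s0)) //= ltnW.
have eL : semi_elementary A0 B C = L.
  apply: (semi_elementary_left (R := R) dAB dAC A0A) => // [P|P|g].
  - exact: grid_sum_support xl.
  - move/(grid_sum_support xr) => [A0P PU]; split=> //.
    apply/subsetP => z /(subsetP PU); have := subsetP A0A z; rewrite !inE.
    by case: (z \in A0) => [/(_ isT) -> //|_] /=.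
  (* The constant 1 has zero increments along [A], so every elementary imset has zero marginal on
     [B]. *)
  - rewrite raddf_sum big_nat big1 // => s sI; rewrite raddf_sum big_nat big1 // => t /andP[_ tB].
    have [xABC _ _ _] := gx s t (ltn_trans sI s0A) tB.
    by rewrite /= (pairing_elementary _ _ dAB xABC) subrr mul0r.
have eR : semi_elementary (A :\: A0) B (A0 :|: C) = R.
  have := eLR; rewrite -{1}(setID A A0) semi_elementaryU (setIidPr A0A) eL.
  exact: addrI.
split=> //.
- by rewrite -(eA0 0) //; have [] := gx s0 0 s0A B0.
- split=> [u nu|].
  + rewrite /left_block /block big_nat big1 // => s sI.
    rewrite big_nat big1 // => t /andP[_ tB].
    case: eqP nu => // ->; rewrite repE ?(ltn_trans _ s0A) //.
    by move/elem_setP=> []; exists (x s t) => //; apply: xl.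
  + rewrite eL /left_block sum_block => [|s t sI /andP[_ tB]]; last first.
      rewrite repE ?(ltn_trans _ s0A) //; apply/elem_setP.
      by exists (x s t) => //; apply: xl.
    apply: eq_big_nat => s sI; apply: eq_big_nat => t /andP[_ tB].
    by rewrite repE // (ltn_trans _ s0A).
- split=> [u nu|].
  + rewrite /right_block /block big_nat big1 // => s sI.
    rewrite big_nat big1 // => t /andP[_ tB].
    case: eqP nu => // ->; rewrite repE //; last by case/andP: sI.
    by move/elem_setP=> []; exists (x s t) => //; apply: xr.
  + rewrite eR /right_block sum_block => [|s t sI /andP[_ tB]]; last first.
      rewrite repE //; last by case/andP: sI.
      by apply/elem_setP; exists (x s t) => //; apply: xr.
    apply: eq_big_nat => s sI; apply: eq_big_nat => t /andP[_ tB].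
    by rewrite repE //; case/andP: sI.
Qed.

Lemma disjointDU (N : finType) (A A0 C : {set N}) :
  [disjoint A & C] -> [disjoint A :\: A0 & A0 :|: C].
Proof.
rewrite -!setI_eq0 setIUr setIDAC setDIl setDv setI0 set0U => /eqP AC0.
by rewrite setIDAC AC0 set0D.
Qed.

Lemma disjointUr (N : finType) (B A0 C : {set N}) :
  [disjoint B & A0] -> [disjoint B & C] -> [disjoint B & A0 :|: C].
Proof. by rewrite -!setI_eq0 setIUr setU_eq0 => -> ->. Qed.

(** Induction on the sum of the two sizes; the bound on [B] passes to both parts of a cut of either
    kind. *)
Lemma thin_decomposable (N : finType) (A B C : {set N}) (theta : Imset N -> nat) :
  [disjoint A & B] -> [disjoint A & C] -> [disjoint B & C] ->
  A != set0 -> B != set0 -> (#|B| <= 2)%N ->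
  representation A B C theta -> sigma_decomposable A B C theta.
Proof.
have [k] := ubnP (#|A| + #|B|); elim: k => // k IH in A B C theta *.
rewrite ltnS => cAB dAB dAC dBC A0 B0 cB rep.
have [x gx] := grid_exists dAB dAC dBC A0 B0 rep.
have A_gt0 : (0 < #|A|)%N by rewrite card_gt0.
have B_gt0 : (0 < #|B|)%N by rewrite card_gt0.
(* Look for a positive height at which all rows agree, that is, a vertical cut. *)
have [/existsP[s0 /andP[s0_gt0 /forallP eqs0]]|noV] := boolP
  [exists s0 : 'I_#|A|, (0 < s0)%N &&
    [forall t : 'I_#|B|, A :&: (x s0 t).2 == A :&: (x s0 0%N).2]].
  set A1 := A :&: (x s0 0%N).2 in eqs0.
  have s0A := ltn_ord s0.
  have sep : separable_A A B C theta s0 A1.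
    apply: (separable_criterion dAB dAC dBC rep gx) => //; first by rewrite s0_gt0.
    by move=> t tB; apply/eqP; apply: (eqs0 (Ordinal tB)).
  have [A1A cA1 repl repr] := sep.
  have cAD : #|A :\: A1| = (#|A| - s0)%N by rewrite cardsDS ?cA1.
  apply: (sigma_split_A (s0 := s0) (A0 := A1)) => //; first by lia.
    apply: IH => //; first by lia.
    - exact: disjointWl A1A dAB.
    - exact: disjointWl A1A dAC.
    - by rewrite -card_gt0; lia.
  apply: IH => //; first by lia.
  - exact: disjointWl (subsetDl _ _) dAB.
  - exact: disjointDU.
  - by apply: disjointUr => //; rewrite disjoint_sym; apply: disjointWl A1A dAB.
  - by rewrite -card_gt0; lia.
have noV' s : (s.+1 < #|A|)%N -> ~ forall t, (t < #|B|)%N ->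
    A :&: (x s.+1 t).2 = A :&: (x s.+1 0%N).2.
  move=> sA eqs; move/existsPn/(_ (Ordinal sA)): noV => /= /negP[].
  by apply/forallP => t; rewrite eqs.
have [B1|B2] : #|B| = 1%N \/ #|B| = 2%N by lia.
  have [A1|A2] : #|A| = 1%N \/ (1 < #|A|)%N by lia.
    exact: sigma_base.
  (* A single row agrees with itself at height 1, so a vertical cut would exist. *)
  by case: (noV' 0%N A2) => -[|t] //; rewrite B1.
set B1 := B :&: (x 0%N 1%N).2.
(* Without a vertical cut, at every interior vertex the two columns must agree, so all columns agree
   at height 1. *)
have eB1 s : (s < #|A|)%N -> B :&: (x s 1%N).2 = B1.
  elim: s => // s IHs sA.
  have B2' : (1 < #|B|)%N by rewrite B2.
  have [eV|->] := interior_vertex dAB dAC dBC rep gx sA B2'; last exact/IHs/ltnW.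
  by case: (noV' s sA) => -[|[|t]] //; rewrite B2.
have sep : separable_B A B C theta 1 B1.
  apply/separable_AC; rewrite disjoint_sym in dAB.
  apply: (separable_criterion dAB dBC dAC (representationC rep) (grid_swap gx)) => //.
  by rewrite B2.
have [B1B cB1 repl repr] := sep.
have cBD : #|B :\: B1| = 1%N by rewrite cardsDS ?cB1 ?B2.
apply: (sigma_split_B (t0 := 1%N) (B0 := B1)) => //; first by rewrite B2.
  apply: IH => //.
  - by rewrite cB1 (leq_trans _ cAB) // B2 ltn_add2l.
  - exact: disjointWr B1B dAB.
  - exact: disjointWl B1B dBC.
  - by rewrite -card_gt0 cB1.
  - by rewrite cB1.
apply: IH => //.
- by rewrite cBD (leq_trans _ cAB) // B2 ltn_add2l.
- exact: disjointWr (subsetDl _ _) dAB.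
- by apply: disjointUr => //; apply: disjointWr B1B dAB.
- exact: disjointDU.
- by rewrite -card_gt0 cBD.
- by rewrite cBD.
Qed.

(** * Which part of a cut an elementary imset goes to *)

Lemma elementary_bottom (N : finType) (x : N * N * {set N}) :
  x.1.1 \notin x.2 -> x.1.2 \notin x.2 -> elementary x x.2 = 1.
Proof.
move=> na nb; have nU (D : {set N}) z : z \notin x.2 -> z \in D -> (x.2 == D) = false.
  by move=> nz zD; apply: contraNF nz => /eqP ->.
rewrite !ffunE eqxx (nU ([set x.1.1] :|: [set x.1.2] :|: x.2) _ na) ?inE ?eqxx //.
by rewrite (nU ([set x.1.1] :|: x.2) _ na) ?(nU ([set x.1.2] :|: x.2) _ nb) ?inE ?eqxx.
Qed.

Lemma elementary_top (N : finType) (x : N * N * {set N}) :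
  x.1.1 \notin x.2 -> x.1.2 \notin x.2 -> x.1.1 != x.1.2 ->
  elementary x ([set x.1.1] :|: [set x.1.2] :|: x.2) = 1.
Proof.
move=> na nb nab; set U := _ :|: x.2.
have nU (D : {set N}) z : z \in U -> z \notin D -> (U == D) = false.
  by move=> zU zD; apply: contraNF zD => /eqP <-.
have [aU bU] : x.1.1 \in U /\ x.1.2 \in U by rewrite !inE !eqxx orbT.
rewrite !ffunE eqxx (nU x.2 _ aU) // (nU _ _ bU) ?(nU _ _ aU) //.
  by rewrite !inE negb_or nab.
by rewrite !inE negb_or eq_sym nab.
Qed.

(** The coefficient is the sum of the two block coefficients, so one is non-zero and u_<a,b|G>
    belongs to the E-set of that part. On the left its top point abG lies in [A0 :|: B :|: C], so a
    is in [A0]; on the right its bottom point G contains [A0]. *)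
Lemma separable_A_cases (N : finType) (A B C : {set N}) (theta : Imset N -> nat)
  (s0 : nat) (A0 : {set N}) (x : N * N * {set N}) :
  [disjoint A & B] -> [disjoint A & C] -> [disjoint B & C] ->
  representation A B C theta -> (s0 <= #|A|)%N -> separable_A A B C theta s0 A0 ->
  x \in triples A B C -> theta (elementary x) != 0%N ->
  (x.1.1 \in A0 /\ left_block A B C theta s0 (elementary x) != 0%N) \/
  A0 \subset x.2.
Proof.
move=> dAB dAC dBC rep s0A [A0A cA0 [repl _] [repr _]] /triplesP[xA xB Cx xU [na nb]].
rewrite -(representation_block dAB dAC dBC rep) /block.
rewrite (big_cat_nat (n := s0)) //= addn_eq0 negb_and => /orP[xl|xr]; [left|right].
  split=> //; move: xl; rewrite -/(block A B C theta 0 s0 0 #|B| _).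
  have [/elem_setP[y yA0 e _]|/repl] := boolP (elementary x \in elem_set A0 B C); last first.
    by rewrite /left_block => ->.
  have nab : x.1.1 != x.1.2 by apply: contraTneq xA => ->; rewrite (disjointFl dAB xB).
  have [_] : C \subset [set x.1.1] :|: [set x.1.2] :|: x.2 /\
      [set x.1.1] :|: [set x.1.2] :|: x.2 \subset A0 :|: B :|: C.
    by apply: (elementary_support yA0); rewrite -e elementary_top.
  rewrite !subUset sub1set !inE (disjointFr dAB xA) (disjointFr dAC xA) !orbF.
  by case/andP=> /andP[].
move: xr; rewrite -/(block A B C theta s0 #|A| 0 #|B| _).
have [/elem_setP[y yA0 e _]|/repr] :=
  boolP (elementary x \in elem_set (A :\: A0) B (A0 :|: C)); last first.
  by rewrite /right_block => ->.
have [] : A0 :|: C \subset x.2 /\ x.2 \subset (A :\: A0) :|: B :|: (A0 :|: C).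
  by apply: (elementary_support yA0); rewrite -e elementary_bottom.
by rewrite subUset => /andP[].
Qed.

Lemma separable_B_cases (N : finType) (A B C : {set N}) (theta : Imset N -> nat)
  (t0 : nat) (B0 : {set N}) (x : N * N * {set N}) :
  [disjoint A & B] -> [disjoint A & C] -> [disjoint B & C] ->
  representation A B C theta -> (t0 <= #|B|)%N -> separable_B A B C theta t0 B0 ->
  x \in triples A B C -> theta (elementary x) != 0%N ->
  (x.1.2 \in B0 /\ lower_block A B C theta t0 (elementary x) != 0%N) \/
  B0 \subset x.2.
Proof.
rewrite disjoint_sym => dAB dAC dBC rep t0B sep xABC thx.
rewrite /lower_block blockC -elementary_swap.
apply: (separable_A_cases (x := swap x) dAB dBC dAC (representationC rep) t0B) => //.
- exact/separable_AC.
- exact: swap_triples.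
- by rewrite elementary_swap.
Qed.

(** * The pinwheel *)

(** A list form of representations: lists of triples can be concatenated and enlarged without
    reference to a coefficient vector. *)
Definition decomposition (N : finType) (A B C : {set N})
  (l : seq (N * N * {set N})) : Prop :=
  {subset l <= triples A B C} /\
  semi_elementary A B C = \sum_(x <- l) elementary x.

Lemma decompositionC (N : finType) (A B C : {set N}) (l : seq (N * N * {set N})) :
  decomposition A B C l -> decomposition B A C [seq swap x | x <- l].
Proof.
case=> sub def_l; split=> [_ /mapP[x xl ->]|]; first exact/swap_triples/sub.
rewrite semi_elementaryC def_l big_map.
by apply: eq_bigr => x _; rewrite elementary_swap.
Qed.

(** The coefficient of an imset is its multiplicity in the list. *)
Lemma representation_of_decomposition (N : finType) (A B C : {set N})
  (l : seq (N * N * {set N})) : decomposition A B C l ->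
  representation A B C (fun u => count_mem u [seq elementary x | x <- l]).
Proof.
case=> sub def_l; split=> [u nu|].
  apply/count_memPn; apply: contra nu => /mapP[x xl ->].
  by apply/elem_setP; exists x => //; apply: sub.
rewrite def_l => {def_l}; elim: l sub => [|x l IH] sub /=.
  by rewrite big_nil big1 // => u _; rewrite mulr0n.
rewrite big_cons IH => [|y yl]; last by apply: sub; rewrite in_cons yl orbT.
under [RHS]eq_bigr do rewrite mulrnDr.
rewrite big_split /=; congr (_ + _).
have xE : elementary x \in elem_set A B C.
  by apply/elem_setP; exists x => //; apply: sub; rewrite mem_head.
rewrite (bigD1_seq (elementary x)) ?fset_uniq //= eqxx mulr1n.
by rewrite big1 ?addr0 // => u; rewrite eq_sym => /negPf ->.
Qed.

Lemma decomposition_cat (N : finType) (A A0 B C : {set N})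
  (l r : seq (N * N * {set N})) : [disjoint A & B] -> [disjoint A & C] ->
  A0 \subset A -> decomposition A0 B C l ->
  decomposition (A :\: A0) B (A0 :|: C) r -> decomposition A B C (l ++ r).
Proof.
move=> dAB dAC A0A [subl suml] [subr sumr]; split=> [x|]; last first.
  rewrite big_cat /= -suml -sumr -[in LHS](setID A A0) (setIidPr A0A).
  exact: semi_elementaryU.
rewrite mem_cat => /orP[/subl|/subr] /triplesP[xA xB Cx xU nx]; apply/triplesP.
  split=> //; first exact: (subsetP A0A).
  by apply: (subset_trans xU); rewrite !setSU.
move: Cx; rewrite subUset => /andP[_ Cx]; split=> //; first by case/setDP: xA.
apply/subsetP => z /(subsetP xU); have := subsetP A0A z; rewrite !inE.
by case: (z \in A0) => [/(_ isT) -> //|_] /=.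
Qed.

(** Split off one element of [A], or of [B], until both have at most one. If one of them is empty
    the semi-elementary imset is 0 and the empty list works. *)
Lemma decomposition_exists (N : finType) (A B C : {set N}) :
  [disjoint A & B] -> [disjoint A & C] -> [disjoint B & C] ->
  exists l, decomposition A B C l.
Proof.
have [k] := ubnP (#|A| + #|B|); elim: k => // k IH in A B C *.
(* Stated for arbitrary sets so that it also serves with [A] and [B] exchanged. *)
have split_A (A' B' C' : {set N}) : (1 < #|A'|)%N -> (#|A'| + #|B'| <= k)%N ->
    [disjoint A' & B'] -> [disjoint A' & C'] -> [disjoint B' & C'] ->
    exists l, decomposition A' B' C' l.
  move=> A2 cAB dAB dAC dBC.
  have /card_gt0P[a aA] : (0 < #|A'|)%N by apply: ltnW.
  have cAD : #|A' :\ a| = #|A'|.-1 by rewrite (cardsD1 a A') aA.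
  have aA' : [set a] \subset A' by rewrite sub1set.
  have [||||l dl] := IH [set a] B' C'; rewrite ?cards1 //; first by lia.
  - exact: disjointWl aA' dAB.
  - exact: disjointWl aA' dAC.
  have [||||r dr] := IH (A' :\ a) B' (a |: C'); rewrite ?cAD //; first by lia.
  - exact: disjointWl (subsetDl _ _) dAB.
  - exact: disjointDU.
  - by apply: disjointUr => //; rewrite disjoint_sym; apply: disjointWl aA' dAB.
  by exists (l ++ r); apply: decomposition_cat dl dr.
rewrite ltnS => cAB dAB dAC dBC.
have [A2|] := ltnP 1 #|A|; first exact: split_A.
have [B2|] := ltnP 1 #|B|.
  move=> _; have [||||l dl] := split_A B A C B2; rewrite // 1?addnC 1?disjoint_sym //.
  by exists [seq swap x | x <- l]; apply: decompositionC.
have nilA (A' B' C' : {set N}) : A' = set0 -> decomposition A' B' C' [::].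
  move=> ->; split=> //; rewrite big_nil /semi_elementary !set0U.
  by rewrite addrK subrr.
rewrite leq_eqVlt ltnS leqn0 => /orP[/cards1P[b eB]|]; last first.
  rewrite cards_eq0 => /eqP B0 _; exists [::].
  exact: (decompositionC (nilA B A C B0)).
rewrite leq_eqVlt ltnS leqn0 => /orP[/cards1P[a eA]|]; last first.
  by rewrite cards_eq0 => /eqP A0; exists [::]; apply: nilA.
move: dAC dBC; rewrite eA eB !disjoints1 => aC bC.
exists [:: (a, b, C)]; split=> [x|]; last by rewrite big_seq1.
by rewrite inE => /eqP ->; apply/triplesP; rewrite !inE !eqxx subsetUr.
Qed.

(** Append any decomposition of the remaining imset u_<A-A0,B|A0 C>. *)
Lemma decomposition_extend (N : finType) (A A0 B C : {set N})
  (l : seq (N * N * {set N})) :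
  [disjoint A & B] -> [disjoint A & C] -> [disjoint B & C] ->
  A0 \subset A -> decomposition A0 B C l ->
  exists2 l', decomposition A B C l' & {subset l <= l'}.
Proof.
move=> dAB dAC dBC A0A dl.
have [|||r dr] := @decomposition_exists _ (A :\: A0) B (A0 :|: C).
- exact: disjointWl (subsetDl _ _) dAB.
- exact: disjointDU.
- by apply: disjointUr => //; rewrite disjoint_sym; apply: disjointWl A0A dAB.
exists (l ++ r); first exact: decomposition_cat dl dr.
by move=> x xl; rewrite mem_cat xl.
Qed.

Definition cell (N : finType) (C : {set N}) (a b : N) (S T : {set N}) :
  N * N * {set N} := (a, b, S :|: T :|: C).

Lemma cell_triples (N : finType) (A B C : {set N}) (a b : N) (S T : {set N}) :
  [disjoint A & B] -> [disjoint A & C] -> [disjoint B & C] ->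
  a \in A -> b \in B -> S \subset A -> T \subset B -> a \notin S -> b \notin T ->
  cell C a b S T \in triples A B C.
Proof.
move=> dAB dAC dBC aA bB SA TB aS bT; apply/triplesP; split=> //=.
- exact: subsetUr.
- by rewrite setSU // setUSS.
rewrite !inE !negb_or aS bT (disjointFr dAC aA) (disjointFr dBC bB) !andbT; split.
  by rewrite (contraFN (subsetP TB a)) ?(disjointFr dAB aA).
by rewrite (contraFN (subsetP SA b)) ?(disjointFl dAB bB).
Qed.

(** The upper sets [S'] and [T'] are separate variables so that each corner can be given the form it
    has in the neighbouring cells. *)
Lemma elementary_cell (N : finType) (C : {set N}) (a b : N) (S T S' T' : {set N}) :
  S' = a |: S -> T' = b |: T ->
  elementary (cell C a b S T) =
    delta (S' :|: T' :|: C) + delta (S :|: T :|: C)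
    - delta (S' :|: T :|: C) - delta (S :|: T' :|: C).
Proof.
move=> -> ->; rewrite /elementary /semi_elementary /=.
have -> : [set a] :|: [set b] :|: (S :|: T :|: C) = a |: S :|: (b |: T) :|: C.
  by rewrite [in RHS]setUACA setUA.
have -> : a |: (S :|: T :|: C) = a |: S :|: T :|: C by rewrite !setUA.
by have -> : b |: (S :|: T :|: C) = S :|: (b |: T) :|: C by rewrite !setUA (setUC S).
Qed.

Lemma uniq3 (T : eqType) (x y z : T) :
  uniq [:: x; y; z] -> [/\ x != y, x != z & y != z].
Proof. by rewrite /= !inE negb_or => /and3P[/andP[]]. Qed.

(* In the coordinates (s,t) the five tiles of the pinwheel are {00,10}, {20,21},
   {12,22}, {01,02} and {11}.  The bottom and top rows are the chains
   1 < 12 < 123 and 2 < 23 < 123 in A, the left and right columns are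
   1 < 13 < 123 and 2 < 12 < 123 in B. *)
Lemma pinwheel_decomposition (N : finType) (C : {set N}) (a1 a2 a3 b1 b2 b3 : N) :
  let A := [set a1; a2; a3] in let B := [set b1; b2; b3] in
  [disjoint A & B] -> [disjoint A & C] -> [disjoint B & C] ->
  uniq [:: a1; a2; a3] -> uniq [:: b1; b2; b3] ->
  decomposition A B C
    [:: cell C a1 b1 set0 set0; cell C a2 b3 set0 [set b1];
        cell C a3 b2 [set a1; a2] set0; cell C a3 b3 [set a2] [set b1; b2];
        cell C a2 b1 [set a1] set0; cell C a3 b1 [set a1; a2] [set b2];
        cell C a2 b2 set0 [set b1; b3]; cell C a1 b2 [set a2] [set b1];
        cell C a1 b3 [set a2; a3] [set b1; b2]].
Proof.
move=> A B dAB dAC dBC /uniq3[n12 n13 n23] /uniq3[m12 m13 m23].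
have [n21 n31 n32] : [/\ a2 != a1, a3 != a1 & a3 != a2] by split; rewrite eq_sym.
have [m21 m31 m32] : [/\ b2 != b1, b3 != b1 & b3 != b2] by split; rewrite eq_sym.
split=> [|].
  apply/allP; rewrite /= !cell_triples //.
  all: rewrite ?sub0set ?subUset ?sub1set ?inE ?eqxx ?orbT //.
  all: rewrite ?negb_or ?n12 ?n13 ?n23 ?m12 ?m13 ?m23 ?n21 ?n31 ?n32 ?m21 ?m31 ?m32 //.
pose d S T : Imset N := delta (S :|: T :|: C).
have dE a b S T S' T' : S' = a |: S -> T' = b |: T ->
    elementary (cell C a b S T) = d S' T' + d S T - d S' T - d S T'.
  exact: elementary_cell.
have -> : semi_elementary A B C = d A B + d set0 set0 - d A set0 - d set0 B.
  by rewrite /d !setU0 !set0U.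
(* From here the corners [d S T] are opaque; once each is written in one fixed form, the inner ones
   cancel by [ring]. *)
rewrite !big_cons big_nil; clearbody d.
have eB : B = b2 |: [set b1; b3] by rewrite setUCA setUA.
rewrite (dE _ _ _ _ _ _ (esym (setU0 [set a1])) (esym (setU0 [set b1]))).
rewrite (dE _ _ _ _ _ _ (setUC [set a1] [set a2]) (esym (setU0 [set b1]))).
rewrite (dE _ _ _ _ _ _ (setUC [set a1; a2] [set a3]) (esym (setU0 [set b2]))).
rewrite (dE _ _ _ _ _ _ (setUC [set a1; a2] [set a3]) (erefl [set b1; b2])).
rewrite (dE _ _ _ _ _ _ (esym (setU0 [set a2])) (setUC [set b1] [set b3])).
rewrite (dE _ _ _ _ _ _ (esym (setU0 [set a2])) eB).
rewrite (dE _ _ _ _ _ _ (erefl [set a1; a2]) (setUC [set b1] [set b2])).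
rewrite (dE _ _ _ _ _ _ (setUC [set a2] [set a3]) (setUC [set b1; b2] [set b3])).
rewrite (dE _ _ _ _ _ _ (esym (setUA [set a1] [set a2] [set a3])) (setUC [set b1; b2] [set b3])).
rewrite -/A -/B; clearbody A B.
by apply/ffunP => P; rewrite !ffunE; ring.
Qed.

Lemma notin_cell (N : finType) (A B C S T : {set N}) (a : N) :
  [disjoint A & B] -> [disjoint A & C] -> a \in A -> a \notin S -> T \subset B ->
  a \notin S :|: T :|: C.
Proof.
move=> dAB dAC aA aS TB; rewrite !inE !negb_or aS (disjointFr dAC aA) andbT.
by rewrite (contraFN (subsetP TB a)) ?(disjointFr dAB aA).
Qed.

(** One cell from each of the four dominoes of the pinwheel: 00, 01, 20 and 12. *)
Lemma pinwheel_triples (N : finType) (A B C : {set N}) (a1 a2 a3 b1 b2 b3 : N) :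
  [disjoint A & B] -> [disjoint A & C] -> [disjoint B & C] ->
  uniq [:: a1; a2; a3] -> uniq [:: b1; b2; b3] ->
  [set a1; a2; a3] \subset A -> [set b1; b2; b3] \subset B ->
  [/\ cell C a1 b1 set0 set0 \in triples A B C,
      cell C a2 b3 set0 [set b1] \in triples A B C,
      cell C a3 b2 [set a1; a2] set0 \in triples A B C
    & cell C a3 b3 [set a2] [set b1; b2] \in triples A B C].
Proof.
move=> dAB dAC dBC /uniq3[n12 n13 n23] /uniq3[m12 m13 m23].
rewrite !subUset !sub1set => /andP[/andP[a1A a2A] a3A] /andP[/andP[b1B b2B] b3B].
split; apply: cell_triples => //;
  rewrite ?subUset ?sub1set ?sub0set ?inE ?negb_or ?a1A ?b1B //.
- by rewrite eq_sym.
- by rewrite ![a3 == _]eq_sym n13.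
- by rewrite eq_sym.
- by rewrite ![b3 == _]eq_sym m13.
Qed.

(* The four cells force the set A0 or B0 of any cut to contain {a1,a2,a3} or
   {b1,b2,b3}, so they all survive in the first part of the cut. *)
Lemma pinwheel_not_decomposable (N : finType) (A B C : {set N})
  (theta : Imset N -> nat) (a1 a2 a3 b1 b2 b3 : N) :
  sigma_decomposable A B C theta ->
  [disjoint A & B] -> [disjoint A & C] -> [disjoint B & C] ->
  representation A B C theta ->
  uniq [:: a1; a2; a3] -> uniq [:: b1; b2; b3] ->
  [set a1; a2; a3] \subset A -> [set b1; b2; b3] \subset B ->
  theta (elementary (cell C a1 b1 set0 set0)) != 0%N ->
  theta (elementary (cell C a2 b3 set0 [set b1])) != 0%N ->
  theta (elementary (cell C a3 b2 [set a1; a2] set0)) != 0%N ->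
  theta (elementary (cell C a3 b3 [set a2] [set b1; b2])) != 0%N -> False.
Proof.
move=> sigma dAB dAC dBC rep uA uB.
have [n12 n13 n23] := uniq3 uA; have [m12 m13 m23] := uniq3 uB.
have [n31 n32] : a3 != a1 /\ a3 != a2 by split; rewrite eq_sym.
have [m31 m32] : b3 != b1 /\ b3 != b2 by split; rewrite eq_sym.
(* In the base case a singleton would contain the distinct elements [a1] and [a2]. *)
elim: sigma dAB dAC dBC rep => {A B C theta} A B C theta.
- move=> /eqP/cards1P[z ->] _ _ _ _ _; rewrite !subUset !sub1set !inE.
  by move=> /andP[/andP[/eqP e1 /eqP e2] _]; rewrite e1 e2 eqxx in n12.
- move=> s0 A0 s0A sep _ IH _ _ dAB dAC dBC rep.
  move=> sA sB; have [tr1 tr2 tr3 tr4] := pinwheel_triples dAB dAC dBC uA uB sA sB.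
  move: sA sB.
  rewrite !subUset !sub1set => /andP[/andP[a1A a2A] a3A] /andP[/andP[b1B b2B] b3B].
  move=> th1 th2 th3 th4; have [A0A cA0 repl _] := sep.
  have /andP[s0_gt0 /leq_trans/(_ (leq_subr _ _)) s0A'] := s0A.
  have out (S T : {set N}) a : a \in A0 -> a \notin S -> T \subset B ->
      ~ A0 \subset S :|: T :|: C.
    move=> aA0 aS TB /subsetP/(_ _ aA0); apply/negP.
    exact: notin_cell dAB dAC (subsetP A0A _ aA0) aS TB.
  (* If [S] misses an element of [A0], the second alternative of [separable_A_cases] fails, so a
     lies in [A0] and the cell stays in the left block. *)
  have keep a b (S T : {set N}) c : theta (elementary (cell C a b S T)) != 0%N ->
      cell C a b S T \in triples A B C -> c \in A0 -> c \notin S -> T \subset B ->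
      a \in A0 /\ left_block A B C theta s0 (elementary (cell C a b S T)) != 0%N.
    move=> th tr cA0' cS TB.
    by have [//|/(out S T c cA0' cS TB)] := separable_A_cases dAB dAC dBC rep s0A' sep tr th.
  (* Starting from any element of [A0], cell 00 yields [a1], then 01 yields [a2], 12 yields [a3],
     and [a3] keeps 20. *)
  have [a0 a0A0] : exists a0, a0 \in A0 by apply/card_gt0P; rewrite cA0.
  have [|||a1A0 l1] := keep _ _ _ _ a0 th1 tr1; rewrite ?inE ?sub0set //.
  have [|||a2A0 l2] := keep _ _ _ _ a1 th2 tr2; rewrite ?inE ?sub1set //.
  have [|||a3A0 l4] := keep _ _ _ _ a1 th4 tr4; rewrite ?inE ?subUset ?sub1set ?b1B //.
  have [|||_ l3] := keep _ _ _ _ a3 th3 tr3; rewrite ?inE ?sub0set ?negb_or ?n31 //.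
  apply: IH => //.
  - exact: disjointWl A0A dAB.
  - exact: disjointWl A0A dAC.
  - by rewrite !subUset !sub1set a1A0 a2A0.
  - by rewrite !subUset !sub1set b1B b2B.
- move=> t0 B0 t0B sep _ IH _ _ dAB dAC dBC rep.
  move=> sA sB; have [tr1 tr2 tr3 tr4] := pinwheel_triples dAB dAC dBC uA uB sA sB.
  move: sA sB.
  rewrite !subUset !sub1set => /andP[/andP[a1A a2A] a3A] /andP[/andP[b1B b2B] b3B].
  move=> th1 th2 th3 th4; have [B0B cB0 repl _] := sep.
  have /andP[t0_gt0 /leq_trans/(_ (leq_subr _ _)) t0B'] := t0B.
  have dBA : [disjoint B & A] by rewrite disjoint_sym.
  have out (S T : {set N}) b : b \in B0 -> b \notin T -> S \subset A ->
      ~ B0 \subset S :|: T :|: C.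
    rewrite (setUC S) => bB0 bT SA /subsetP/(_ _ bB0); apply/negP.
    exact: notin_cell dBA dBC (subsetP B0B _ bB0) bT SA.
  have keep a b (S T : {set N}) c : theta (elementary (cell C a b S T)) != 0%N ->
      cell C a b S T \in triples A B C -> c \in B0 -> c \notin T -> S \subset A ->
      b \in B0 /\ lower_block A B C theta t0 (elementary (cell C a b S T)) != 0%N.
    move=> th tr cB0' cT SA.
    by have [//|/(out S T c cB0' cT SA)] := separable_B_cases dAB dAC dBC rep t0B' sep tr th.
  (* Likewise 00 yields [b1], 20 yields [b2], 01 yields [b3], and [b3] keeps 12. *)
  have [b0 b0B0] : exists b0, b0 \in B0 by apply/card_gt0P; rewrite cB0.
  have [|||b1B0 l1] := keep _ _ _ _ b0 th1 tr1; rewrite ?inE ?sub0set //.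
  have [|||b2B0 l3] := keep _ _ _ _ b1 th3 tr3; rewrite ?inE ?subUset ?sub1set ?a1A //.
  have [|||b3B0 l2] := keep _ _ _ _ b2 th2 tr2; rewrite ?inE ?sub0set 1?eq_sym //.
  have [|||_ l4] := keep _ _ _ _ b3 th4 tr4; rewrite ?inE ?sub1set ?negb_or ?m31 //.
  apply: IH => //.
  - exact: disjointWr B0B dAB.
  - exact: disjointWl B0B dBC.
  - by rewrite !subUset !sub1set a1A a2A.
  - by rewrite !subUset !sub1set b1B0 b2B0.
Qed.

Lemma three_elements (N : finType) (A : {set N}) : (2 < #|A|)%N ->
  exists a1 a2 a3, uniq [:: a1; a2; a3] /\ [set a1; a2; a3] \subset A.
Proof.
case/card_gt2P=> a1 [a2 [a3 [[a1A a2A a3A] [n12 n23 n31]]]].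
exists a1, a2, a3; rewrite !subUset !sub1set a1A a2A a3A /= !inE negb_or.
by rewrite n12 n23 eq_sym n31.
Qed.

(** Place the pinwheel on three elements of each set and extend it first in [A], then in [B] after a
    swap; its cells keep non-zero coefficients. *)
Lemma thick_not_decomposable (N : finType) (A B C : {set N}) :
  [disjoint A & B] -> [disjoint A & C] -> [disjoint B & C] ->
  (2 < #|A|)%N -> (2 < #|B|)%N ->
  exists2 theta, representation A B C theta & ~ sigma_decomposable A B C theta.
Proof.
move=> dAB dAC dBC /three_elements[a1 [a2 [a3 [uA sA]]]].
move=> /three_elements[b1 [b2 [b3 [uB sB]]]].
have dA3B3 := disjointW sA sB dAB.
have dec := pinwheel_decomposition dA3B3 (disjointWl sA dAC) (disjointWl sB dBC) uA uB.
have [l dl sub_l] :=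
  decomposition_extend (disjointWr sB dAB) dAC (disjointWl sB dBC) sA dec.
have dBA : [disjoint B & A] by rewrite disjoint_sym.
have [r dr sub_r] := decomposition_extend dBA dBC dAC sB (decompositionC dl).
have rep := representation_of_decomposition (decompositionC dr).
exists (fun u => count_mem u [seq elementary x | x <- [seq swap x | x <- r]]) => //.
have mem_r x : x \in l ->
    count_mem (elementary x) [seq elementary y | y <- [seq swap y | y <- r]] != 0%N.
  move=> xl; rewrite -lt0n -has_count has_pred1 map_f //.
  have -> : x = swap (swap x) by case: (x) => -[].
  by apply/map_f/sub_r/map_f.
move=> /pinwheel_not_decomposable/(_ dAB dAC dBC rep uA uB sA sB).
by apply; apply: mem_r; apply: sub_l; rewrite !inE eqxx ?orbT.
Qed.

End Imsets.

Theorem proposition2 (N : finType) (A B C : {set N}) :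
  [disjoint A & B] -> [disjoint A & C] -> [disjoint B & C] ->
  A != set0 -> B != set0 ->
  (forall theta : Imset N -> nat,
     representation A B C theta -> sigma_decomposable A B C theta) <->
  #|A| <= 2 \/ #|B| <= 2.
Proof.
move=> dAB dAC dBC A0 B0; split=> [all_dec|thin theta rep]; last first.
  (* [thin_decomposable] bounds the second set, so a small [A] is treated with the two sets
     exchanged. *)
  case: thin => ?; [apply: sigma_decomposableC | exact: thin_decomposable].
  by apply: thin_decomposable (representationC rep); rewrite // disjoint_sym.
apply/orP; apply: contraT; rewrite negb_or -!ltnNge => /andP[A3 B3].
have [theta rep nsd] := thick_not_decomposable dAB dAC dBC A3 B3.
by case: nsd; apply: all_dec.
Qed.
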